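(* Let $\mathcal{M}=(\mathcal{M}_t)_{t\ge0}$ be a smooth Mallows process on $\mathcal{S}_n$. Then $\mathcal{G}_\mathcal{M}$ is a subgraph of $\mathcal{H}_n$, and $\mathcal{T}^a\subseteq\langle\mathcal{G}_\mathcal{M}\rangle\subseteq\mathcal{T}$. Moreover, if $\mathcal{M}$ is regular, then $\mathcal{G}_\mathcal{M}=\mathcal{H}_n$ and $\langle\mathcal{G}_\mathcal{M}\rangle=\langle\mathcal{H}_n\rangle=\mathcal{T}$.
   Context: $\mathcal{S}_n$, $\mathrm{Inv}$, $\mathrm{Inv}_j$ as usual: $\mathrm{Inv}(\sigma)=|\{i<j:\sigma(i)>\sigma(j)\}|$, $\mathrm{Inv}_j(\sigma)=|\{i\in[j-1]:\sigma(i)>\sigma(j)\}|$. Composition: $(\sigma\cdot\sigma')(i)=\sigma(\sigma'(i))$. The Mallows distribution $\pi_{n,q}(\sigma)=q^{\mathrm{Inv}(\sigma)}/\prod_{k=1}^n\sum_{\ell=0}^{k-1}q^\ell$ ($0^0=1$). A Mallows process is an $\mathcal{S}_n$-valued càdlàg process with $\mathcal{M}_t\sim\pi_{n,t}$ for all $t\ge0$. It is strongly monotone if $t\mapsto\mathrm{Inv}_j(\mathcal{M}_t)$ is nondecreasing for each $j\in[n]$; smooth if strongly monotone and $\mathrm{Inv}(\mathcal{M}_t)\le\mathrm{Inv}(\mathcal{M}_{t-})+1$ for all $t$; regular if smooth and the processes $(\mathrm{Inv}_j(\mathcal{M}_t))_{t\ge0}$, $j\in[n]$, are mutually independent. The transition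 graph $\mathcal{G}_\mathcal{M}$ is the undirected graph on $\mathcal{S}_n$ with edge set $\{(\sigma,\sigma'):\mathbb{P}(\exists t\in(0,\infty):\mathcal{M}_{t-}=\sigma,\mathcal{M}_t=\sigma')>0\}$. For a graph $\mathcal{G}$ on $\mathcal{S}_n$, its generator is $\langle\mathcal{G}\rangle=\{\sigma^{-1}\cdot\sigma':(\sigma,\sigma')\in E(\mathcal{G})\}$. $\mathcal{T}$ is the set of all transpositions $(i\,j)$, $i\ne j$, and $\mathcal{T}^a=\{(i\,i{+}1):i\in[n-1]\}$ the adjacent transpositions. The expanded hypercube $\mathcal{H}_n$ is the graph on $\mathcal{S}_n$ with edges $\{(\sigma,\sigma'):\sum_{j=1}^n|\mathrm{Inv}_j(\sigma)-\mathrm{Inv}_j(\sigma')|=1\}$. *)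

(* Defs.v *)
From HB Require Import structures.
From mathcomp Require Import all_boot all_order all_algebra all_fingroup.
From mathcomp Require Import all_classical all_reals all_analysis.
Set Implicit Arguments. Unset Strict Implicit. Unset Printing Implicit Defensive.
Import Order.TTheory GRing.Theory Num.Theory.
Local Open Scope classical_set_scope.
Local Open Scope ring_scope.

(* Positions and values are 0-based: 'I_n = {0,...,n-1} stands for [n]. *)

Definition Inv (n : nat) (s : 'S_n) : nat :=
  #|[set p : 'I_n * 'I_n | (p.1 < p.2)%N && (s p.2 < s p.1)%N]|.

Definition Invj (n : nat) (j : 'I_n) (s : 'S_n) : nat :=
  #|[set i : 'I_n | (i < j)%N && (s j < s i)%N]|.

(* Mallows distribution pi_{n,q}; note q ^+ 0 = 1 also for q = 0. *)
Definition mallows_pi (R : realFieldType) (n : nat) (q : R) (s : 'S_n) : R :=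
  q ^+ Inv s / \prod_(k < n) \sum_(l < k.+1) q ^+ l.

(* Composition as in the paper: (compose s s') i = s (s' i).
   (MathComp's group product satisfies (s' * s) i = s (s' i).) *)
Definition compose (n : nat) (s s' : 'S_n) : 'S_n := (s' * s)%g.

Definition left_lim (R : realType) (X : Type) (f : R -> X) (t : R) (x : X) : Prop :=
  exists e : R, 0 < e /\ forall s, t - e < s -> s < t -> f s = x.

(* cadlag path on [0, oo) with values in a finite discrete space *)
Definition cadlag (R : realType) (X : Type) (f : R -> X) : Prop :=
  (forall t, 0 <= t -> exists e : R, 0 < e /\ forall s, t <= s -> s < t + e -> f s = f t)
  /\ (forall t, 0 < t -> exists x, left_lim f t x).

Definition mallows_process (d : measure_display) (T : measurableType d)
    (R : realType) (P : probability T R) (n : nat) (M : R -> T -> 'S_n) : Prop :=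
  [/\ (forall t s, 0 <= t -> measurable [set w | M t w = s]),
      (forall w, cadlag (fun t => M t w)) &
      (forall t s, 0 <= t -> P [set w | M t w = s] = (mallows_pi t s)%:E)].

Definition strongly_monotone (d : measure_display) (T : measurableType d)
    (R : realType) (P : probability T R) (n : nat) (M : R -> T -> 'S_n) : Prop :=
  mallows_process P M /\
  forall w (j : 'I_n) t t', 0 <= t -> t <= t' -> (Invj j (M t w) <= Invj j (M t' w))%N.

Definition smooth (d : measure_display) (T : measurableType d)
    (R : realType) (P : probability T R) (n : nat) (M : R -> T -> 'S_n) : Prop :=
  strongly_monotone P M /\
  forall w t (s : 'S_n), 0 < t -> left_lim (fun u => M u w) t s ->
    (Inv (M t w) <= (Inv s).+1)%N.

(* Mutual independence of the processes (Inv_j(M_t))_{t>=0}, j in [n]: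
   product rule for every subfamily J of indices and every finite-dimensional
   (point) cylinder event, with times ts (all >= 0) and prescribed values v j k
   for Inv_j at time nth 0 ts k. *)
Definition inv_cyl_event (T : Type) (R : realType) (n : nat) (M : R -> T -> 'S_n)
    (ts : seq R) (v : 'I_n -> nat -> nat) (j : 'I_n) : set T :=
  [set w | forall k, (k < size ts)%N -> Invj j (M (nth 0 ts k) w) = v j k].

Definition inv_processes_independent (d : measure_display) (T : measurableType d)
    (R : realType) (P : probability T R) (n : nat) (M : R -> T -> 'S_n) : Prop :=
  forall (J : {set 'I_n}) (ts : seq R) (v : 'I_n -> nat -> nat),
    (forall k, (k < size ts)%N -> 0 <= nth 0 ts k) ->
    (P [set w | forall j, j \in J -> inv_cyl_event M ts v j w]
     = \prod_(j in J) P (inv_cyl_event M ts v j))%E.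

Definition regular (d : measure_display) (T : measurableType d)
    (R : realType) (P : probability T R) (n : nat) (M : R -> T -> 'S_n) : Prop :=
  smooth P M /\ inv_processes_independent P M.

Definition jump_event (T : Type) (R : realType) (n : nat) (M : R -> T -> 'S_n)
    (s s' : 'S_n) : set T :=
  [set w | exists t, 0 < t /\ left_lim (fun u => M u w) t s /\ M t w = s'].

Definition trans_edge (d : measure_display) (T : measurableType d)
    (R : realType) (P : probability T R) (n : nat) (M : R -> T -> 'S_n)
    (s s' : 'S_n) : Prop :=
  s != s' /\ ((0 < P (jump_event M s s'))%E \/ (0 < P (jump_event M s' s))%E).

Definition distn (a b : nat) : nat := (a - b) + (b - a).

Definition hcube_edge (n : nat) (s s' : 'S_n) : Prop :=
  (\sum_(j < n) distn (Invj j s) (Invj j s') = 1)%N.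

Definition generator (n : nat) (E : 'S_n -> 'S_n -> Prop) (tau : 'S_n) : Prop :=
  exists s s', E s s' /\ tau = compose (s^-1)%g s'.

Definition transposition (n : nat) (tau : 'S_n) : Prop :=
  exists i j : 'I_n, i != j /\ tau = tperm i j.

Definition adjacent_transposition (n : nat) (tau : 'S_n) : Prop :=
  exists i j : 'I_n, val j = (val i).+1 /\ tau = tperm i j.

(* Main.v *)
(* A permutation is determined by its code (Inv_j)_j, and adding 1 to one
   coordinate of the code amounts to swapping the value at that position with
   the next smaller value to its left; so hypercube edges are transpositions.
   The code of a smooth path is nondecreasing and jumps by one unit vector, so
   every jump is a hypercube edge.  If the code of s' exceeds that of s by a
   unit vector, then the path jumps from s to s' as soon as M_p = s and M_q = s'
   for some p <= q, because no other state fits in between; restricting to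
   rational times makes the jump event measurable.  For s = 1 and s' an adjacent
   transposition, p = 0 and q = 1 work since M_0 = 1 a.s.  In the regular case
   let a be a point of increase of t |-> P(Inv_j(M_t) > Inv_j(s)).  For b > a
   close to a, each other coordinate k equals Inv_k(s) at both a and b, hence on
   all of [a, b], with positive probability, while coordinate j makes the
   required step between some rationals of [a, b] with positive probability;
   independence at these two rational times concludes. *)

Require Import Defs.
From HB Require Import structures.
From mathcomp Require Import all_boot all_order all_algebra all_fingroup.
From mathcomp Require Import all_classical all_reals all_analysis.
From mathcomp Require Import zify lra.
Set Implicit Arguments. Unset Strict Implicit. Unset Printing Implicit Defensive.
Import Order.TTheory GRing.Theory Num.Theory.

(** * Inversion codes of permutations *)

Lemma InvjE (n : nat) (j : 'I_n) (s : 'S_n) :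
  Invj j s = #|[set i : 'I_n | (i < j)%N && (s j < s i)%N]|.
(* In [Invj] the brackets form a classical set, here a finset; membership in the former is an
   [asbool]. *)
Proof. by apply: eq_card => i; rewrite !inE; apply: asboolb. Qed.

Lemma Inv_sum (n : nat) (s : 'S_n) : Defs.Inv s = (\sum_(j < n) Invj j s)%N.
Proof.
rewrite /Defs.Inv -sum1_card (eq_bigl (fun p : 'I_n * 'I_n =>
  xpredT p.2 && ((p.1 < p.2)%N && (s p.2 < s p.1)%N))); last by move=> p; apply: asboolb.
rewrite (reindex (fun p : 'I_n * 'I_n => (p.2, p.1))) /=; last first.
  by exists (fun p => (p.2, p.1)) => -[].
rewrite -(pair_big_dep xpredT (fun j i : 'I_n => (i < j)%N && (s j < s i)%N)
  (fun _ _ => 1%N)) /=.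
by apply: eq_bigr => j _; rewrite InvjE -sum1_card; apply: eq_bigl => i; rewrite inE.
Qed.

Lemma card_ord_lt (n : nat) (j : 'I_n) : #|[set i : 'I_n | (i < j)%N]| = j.
Proof.
have wi : injective (widen_ord (ltnW (ltn_ord j))) by move=> x y /(congr1 val) /= /val_inj.
rewrite -[RHS]card_ord -(card_codom wi); apply: eq_card => i; rewrite inE.
apply/idP/codomP => [ij|[k ->]]; last exact: (ltn_ord k).
by exists (Ordinal ij); apply: val_inj.
Qed.

Lemma Invj_le (n : nat) (j : 'I_n) (s : 'S_n) : (Invj j s <= j)%N.
Proof.
rewrite InvjE; apply: (leq_trans _ (eq_leq (card_ord_lt j))).
by apply: subset_leq_card; apply/fintype.subsetP => i; rewrite !inE => /andP[].
Qed.

(** Substitute [v = s i]; [<=] may replace [<] because position [j] itself fails [s j < v]. In this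
    form the count depends only on [s j] and on the set of values at positions up to [j]. *)
Lemma Invj_values (n : nat) (j : 'I_n) (s : 'S_n) :
  Invj j s = #|[set v : 'I_n | (s^-1%g v <= j)%N && (s j < v)%N]|.
Proof.
rewrite InvjE -(card_imset _ (@perm_inj _ s)); apply: eq_card => v.
apply/imsetP/idP => [[i]|].
  by rewrite !inE => /andP[ij sji] ->; rewrite permK (ltnW ij).
rewrite inE => /andP[vj sjv]; exists (s^-1%g v); rewrite ?permKV// inE permKV sjv andbT.
rewrite ltn_neqAle vj andbT; apply: contraTneq sjv => /val_inj <-.
by rewrite permKV ltnn.
Qed.

(** Let [j] be the last position where the permutations differ. The values at positions up to [j]
    form the same set for both, and the entry at [j] counts those above the value at [j], so the
    smaller value there gives the strictly larger entry. *)
Lemma Invj_inj (n : nat) (s s' : 'S_n) : (forall j, Invj j s = Invj j s') -> s = s'.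
Proof.
move=> eqI; apply/eqP/negPn/negP => neq.
have [i0 i0P] : exists i, s i != s' i.
  apply/existsP; apply: contraNT neq; rewrite negb_exists => /forallP h.
  by apply/eqP/permP => i; apply/eqP; rewrite -[_ == _]negbK h.
pose j := [arg max_(i > i0 | s i != s' i) (i : nat)].
have [sj jmax] : s j != s' j /\ forall k : 'I_n, (j < k)%N -> s k = s' k.
  rewrite /j; case: arg_maxnP => // j' sj' mx; split=> // k jk.
  by apply/eqP; apply: contraTT jk => /mx; rewrite -leqNgt.
clearbody j.
wlog lt : s s' eqI sj jmax {neq i0 i0P} / (s j < s' j)%N.
  move=> wl; case: (ltngtP (s j) (s' j)) => [|gt|/val_inj e].
  - exact: wl.
  - apply: (wl s' s) => //; first by rewrite eq_sym.
    by move=> k /jmax.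
  - by rewrite e eqxx in sj.
have pre v : (s^-1%g v <= j)%N = (s'^-1%g v <= j)%N.
  rewrite leqNgt [RHS]leqNgt; congr (~~ _); apply/idP/idP => h.
  - by have := jmax _ h; rewrite permKV => {1}->; rewrite permK.
  - by have := jmax _ h; rewrite permKV => {1}<-; rewrite permK.
suff : (Invj j s' < Invj j s)%N by rewrite (eqI j) ltnn.
rewrite !Invj_values; apply: proper_card; apply/properP; split.
  apply/fintype.subsetP => v; rewrite !inE pre => /andP[-> /=]; exact: ltn_trans.
(* The value [s' j] is counted for [s] but not for [s']. *)
by exists (s' j); rewrite !inE ?pre ?permK ?leqnn ?lt// ltnn andbF.
Qed.

(** The values at [i] and [j] are exchanged. By the gap hypothesis both compare alike with every
    other value to the left of [j], so the only new inversion is the pair [(i, j)], charged to [j];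
    entries beyond [j] see the same set of values to their left. *)
Lemma Invj_swap (n : nat) (s : 'S_n) (i j : 'I_n) : (i < j)%N -> (s i < s j)%N ->
  (forall k : 'I_n, (k < j)%N -> k != i -> (s i < s k)%N = (s j < s k)%N) ->
  forall k, Invj k (tperm i j * s)%g = (Invj k s + (k == j))%N.
Proof.
move=> ij sij gap k.
have [->|ki] := eqVneq k i.
  have -> : (i == j) = false by apply/negbTE; rewrite neq_ltn ij.
  rewrite addn0 !InvjE; apply: eq_card => l; rewrite !inE !permM tpermL.
  case: ltnP => //= li; have lj := ltn_trans li ij.
  have nli : l != i by rewrite neq_ltn li.
  by rewrite tpermD 1?eq_sym// ?gap// neq_ltn lj.
have [->|kj] := eqVneq k j.
  rewrite addn1 !InvjE.
  have -> : [set l : 'I_n | (l < j)%N && ((tperm i j * s)%g j < (tperm i j * s)%g l)%N] =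
    i |: [set l : 'I_n | (l < j)%N && (s j < s l)%N].
    apply/finset.setP => l; rewrite !inE !permM tpermR.
    have [->|li] := eqVneq l i; first by rewrite tpermL ij sij.
    case: ltnP => //= lj; rewrite tpermD 1?eq_sym ?gap//.
    by rewrite neq_ltn lj.
  by rewrite cardsU1 inE ij /= ltnNge (ltnW sij) add1n.
rewrite addn0.
have [jk|kj'] := ltnP j k.
  (* Beyond [j], the counted positions are merely permuted by [tperm i j]. *)
  rewrite !InvjE -[RHS](card_imset _ (@perm_inj _ (tperm i j))); apply: eq_card => l.
  rewrite -{2}(tpermK i j l) mem_imset; last exact: perm_inj.
  rewrite !inE !permM (tpermD (z:=k)) 1?eq_sym//; congr (_ && _).
  by case: tpermP => // ->; rewrite ?jk ?(ltn_trans ij jk).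
rewrite !InvjE; apply: eq_card => l; rewrite !inE !permM (tpermD (z:=k)) 1?eq_sym//.
have kltj : (k < j)%N by rewrite ltn_neqAle kj' andbT.
case: ltnP => //= lk; have [->|li] := eqVneq l i.
  have flip a : k != a -> (s k < s a)%N = ~~ (s a < s k)%N.
    move=> ka; rewrite -leqNgt ltn_neqAle; case: eqVneq => // /val_inj/perm_inj e.
    by rewrite e eqxx in ka.
  by rewrite tpermL !flip// gap.
by rewrite tpermD// 1?eq_sym// neq_ltn (ltn_trans lk).
Qed.

(** The witness [i] carries the largest value below [s j] to the left of [j], which gives the gap
    condition of [Invj_swap]. Such a value exists because fewer than [j] of the [j] values on the
    left are larger. *)
Lemma Invj_incr (n : nat) (s : 'S_n) (j : 'I_n) : (Invj j s < j)%N ->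
  exists i : 'I_n, i != j /\ forall k, Invj k (tperm i j * s)%g = (Invj k s + (k == j))%N.
Proof.
move=> lt.
have [i0 /andP[i0j i0s]] : exists i : 'I_n, (i < j)%N && (s i < s j)%N.
  apply/existsP; apply: contraTT lt; rewrite negb_exists -leqNgt => /forallP h.
  rewrite InvjE; apply: (leq_trans (eq_leq (esym (card_ord_lt j)))).
  apply: subset_leq_card; apply/fintype.subsetP => i; rewrite !inE => ij.
  have := h i; rewrite ij /= -leqNgt leq_eqVlt => /orP[/eqP/val_inj/perm_inj e|//].
  by rewrite e ltnn in ij.
pose i := [arg max_(i > i0 | (i < j)%N && (s i < s j)%N) (s i : nat)].
have [ij sij imax] : [/\ (i < j)%N, (s i < s j)%N &
    forall k : 'I_n, (k < j)%N -> (s k < s j)%N -> (s k <= s i)%N].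
  rewrite /i; case: arg_maxnP; first by rewrite i0j.
  move=> i' /andP[? ?] mx; split=> // k kj skj; apply: mx.
  by rewrite kj skj.
exists i; split; first by rewrite neq_ltn ij.
apply: Invj_swap => // k kj ki; apply/idP/idP; last exact: ltn_trans.
rewrite !ltnNge; apply: contra; rewrite leq_eqVlt => /orP[/eqP/val_inj/perm_inj e|].
  by rewrite e ltnn in kj.
exact: imax.
Qed.

(** * Hypercube edges and transpositions *)

(** The covering relation of the componentwise order on codes, that is, a hypercube edge oriented
    upwards. *)
Definition code_step (n : nat) (s s' : 'S_n) : Prop :=
  exists j : 'I_n, forall k, Invj k s' = (Invj k s + (k == j))%N.

Lemma hcube_edge_sym (n : nat) (s s' : 'S_n) : hcube_edge s s' -> hcube_edge s' s.
Proof.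
by rewrite /hcube_edge => <-; apply: eq_bigr => j _; rewrite /distn addnC.
Qed.

Lemma code_step_edge (n : nat) (s s' : 'S_n) : code_step s s' -> hcube_edge s s'.
Proof.
case=> j h; rewrite /hcube_edge (bigD1 j)//= big1 => [|k /negbTE kj].
  by rewrite /distn h eqxx; lia.
by rewrite /distn h kj; lia.
Qed.

Lemma edge_code_step (n : nat) (s s' : 'S_n) : hcube_edge s s' ->
  code_step s s' \/ code_step s' s.
Proof.
rewrite /hcube_edge => sum1.
have [j jP] : exists j : 'I_n, distn (Invj j s) (Invj j s') != 0%N.
  apply/existsP; apply: contra_eqT sum1; rewrite negb_exists => /forallP h.
  by rewrite big1// => j _; apply/eqP; rewrite -[_ == _]negbK h.
move: sum1; rewrite (bigD1 j)//= => sum1.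
have {}jP : (0 < distn (Invj j s) (Invj j s'))%N by rewrite lt0n.
have /eqP : (\sum_(k < n | k != j) distn (Invj k s) (Invj k s') = 0)%N.
  move: jP sum1; case: distn => // m _; rewrite addSn => -[/eqP].
  by rewrite addn_eq0 => /andP[_ /eqP].
rewrite sum_nat_eq0 => /forallP oth.
have eqk k : k != j -> Invj k s = Invj k s'.
  by move=> kj; have := implyP (oth k) kj; rewrite /distn; lia.
have [lt|lt] := leqP (Invj j s) (Invj j s'); [left|right]; exists j => k;
  have [->|/[dup]/eqk -> _] := eqVneq k j; rewrite ?addn0//; move: sum1 jP; rewrite /distn; lia.
Qed.

Lemma code_step_neq (n : nat) (s s' : 'S_n) : code_step s s' -> s != s'.
Proof.
by case=> j h; apply/eqP => e; have := h j; rewrite e eqxx; lia.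
Qed.

Lemma composeE (n : nat) (s s' t : 'S_n) : t = compose s^-1%g s' <-> s' = (t * s)%g.
Proof.
rewrite /compose; split=> ->; first by rewrite mulgKV.
by rewrite mulgK.
Qed.

Lemma code_step_transposition (n : nat) (s s' : 'S_n) : code_step s s' ->
  transposition (compose s^-1%g s').
Proof.
case=> j h; have [|i [ij hi]] := @Invj_incr n s j.
  by apply: leq_trans (Invj_le j s'); rewrite h eqxx addn1.
exists i, j; split=> //; apply/esym/composeE/Invj_inj => k; by rewrite h hi.
Qed.

Lemma generator_hcube (n : nat) (tau : 'S_n) :
  generator (@hcube_edge n) tau <-> transposition tau.
Proof.
split.
  move=> [s [s' [/edge_code_step[]/code_step_transposition tr ->//]]].
  case: tr => i [j [ij e]]; exists i, j; split=> //.
  (* A downward edge yields the inverse of a transposition, which is the same transposition. *)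
  by rewrite -tpermV -e /compose invMg invgK.
move=> [i [j [ij ->]]]; wlog lt : i j ij / (i < j)%N.
  move=> wl; have := ij; rewrite neq_ltn => /orP[|lt]; first exact: wl.
  by rewrite tpermC; apply: wl; rewrite // eq_sym.
(* With [s i = i] and [s j = i + 1], the positions [i] and [j] carry consecutive values, so nothing
   lies between them and [Invj_swap] applies. *)
pose i' := Ordinal (leq_ltn_trans lt (ltn_ord j)).
pose s : 'S_n := tperm i' j.
have si : s i = i by rewrite tpermD// 1?eq_sym//; apply/eqP => /(congr1 val) /=; lia.
have sj : s j = i' by rewrite tpermR.
exists s, (tperm i j * s)%g; split; last by apply/composeE.
apply: code_step_edge; exists j; apply: Invj_swap => //; first by rewrite si sj.
move=> k kj ki; rewrite si sj /= [RHS]ltn_neqAle; case: eqVneq => // e.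
suff kj' : k = j by rewrite kj' ltnn in kj.
by apply: (@perm_inj _ s); rewrite sj; apply: val_inj.
Qed.

(** * Jumps of monotone cadlag paths *)

Import numFieldNormedType.Exports.
Local Open Scope classical_set_scope.
Local Open Scope ring_scope.

(** A nonzero componentwise increase of total at most one is a unit vector. *)
Lemma code_step_le (n : nat) (s s' : 'S_n) :
  (forall k, (Invj k s <= Invj k s')%N) -> (Defs.Inv s' <= (Defs.Inv s).+1)%N ->
  s != s' -> code_step s s'.
Proof.
move=> le_code; rewrite !Inv_sum => le1 neq.
have [j neqj] : exists j, Invj j s != Invj j s'.
  apply/existsP; apply: contraNT neq; rewrite negb_exists => /forallP h.
  by apply/eqP/Invj_inj => j; apply/eqP; rewrite -[_ == _]negbK h.
have ltj : (Invj j s < Invj j s')%N by rewrite ltn_neqAle neqj le_code.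
move: le1; rewrite (bigD1 j)//= [in X in (_ <= X)%N](bigD1 j)//=.
have [] := leqif_sum (P := fun i => i != j) (fun i _ => leqif_eq (le_code i)).
set A := bigop _ _ _; set B := bigop _ _ _ => leAB eqAB le1.
(* The only unit is spent at [j], so the remaining sums agree; the equality case of [leqif_sum] then
   makes the other coordinates agree. *)
have /eqP : A = B by lia.
rewrite eqAB => /'forall_implyP eqk; exists j => k.
have [->|/eqk/eqP ->] := eqVneq k j; last by rewrite addn0.
by lia.
Qed.

Definition mono_path (R : realType) (n : nat) (f : R -> 'S_n) : Prop :=
  forall j t t', 0 <= t -> t <= t' -> (Invj j (f t) <= Invj j (f t'))%N.

Section paths.
Variables (R : realType) (n : nat) (f : R -> 'S_n).
Hypotheses (rc : cadlag f) (mono : mono_path f).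

(** A left limit in a discrete space is attained on a whole interval, which contains rationals.
    Together with [right_rat] this trades real jump times for rational ones. *)
Lemma left_lim_rat (t a : R) (x : 'S_n) : left_lim f t x -> a < t ->
  exists q : rat, [/\ a < ratr q, ratr q < t & f (ratr q) = x].
Proof.
move=> [e [e0 fx]] at_.
have /rat_in_itvoo[q] : Num.max a (t - e) < t by rewrite gt_max at_ ltrBlDr ltrDl.
rewrite in_itv/= gt_max => /andP[/andP[aq tq] qt]; exists q; split=> //; exact: fx.
Qed.

Lemma right_rat (t b : R) : 0 <= t -> t < b ->
  exists q : rat, [/\ t < ratr q, ratr q < b & f (ratr q) = f t].
Proof.
move=> t0 tb; have [e [e0 fx]] := rc.1 t t0.
have /rat_in_itvoo[q] : t < Num.min b (t + e) by rewrite lt_min tb ltrDl.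
rewrite in_itv/= lt_min => /andP[tq /andP[qb qe]]; exists q; split=> //.
by apply: fx => //; exact: ltW.
Qed.

(** A discrete intermediate value property: [t] is the supremum of the times at which coordinate [j]
    is at most [c]. *)
Lemma Invj_crossing (j : 'I_n) (c : nat) (u v : R) : 0 <= u -> u <= v ->
  (Invj j (f u) <= c < Invj j (f v))%N ->
  exists t x, [/\ u < t, t <= v, left_lim f t x & (Invj j x <= c < Invj j (f t))%N].
Proof.
move=> u0 uv /andP[fu fv].
pose S := [set r | u <= r /\ (Invj j (f r) <= c)%N].
have Su : S u by split.
have Sv : ubound S v.
  move=> r [ur fr]; rewrite leNgt; apply/negP => /ltW vr.
  by have := leq_trans fv (leq_trans (mono j (le_trans u0 uv) vr) fr); rewrite ltnn.
have supS : has_sup S by split; [exists u|exists v].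
set t := sup S.
have ut : u <= t by apply: ub_le_sup => //; exists v.
have tv : t <= v by apply: ge_sup => //; exists u.
have t0 : 0 <= t := le_trans u0 ut.
have ft : (c < Invj j (f t))%N.
  rewrite ltnNge; apply/negP => ftc; have [e [e0 fe]] := rc.1 t t0.
  (* By right-continuity a value at most [c] at [t] would persist beyond the supremum. *)
  have : S (t + e / 2).
    split; first by rewrite (le_trans ut)// lerDl divr_ge0// ltW.
    by rewrite fe// ?lerDl ?divr_ge0// 1?ltW//; lra.
  by move/(ub_le_sup supS.2); rewrite -/t; lra.
have {}ut : u < t.
  by rewrite lt_neqAle ut andbT; apply: contraTneq ft => <-; rewrite -leqNgt.
have [x lx] := rc.2 t (le_lt_trans u0 ut).
exists t, x; split=> //; rewrite ft andbT.
(* Elements of [S] come arbitrarily close to [t] from the left, so the left limit is a value taken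
   on [S]. *)
have [e [e0 fe]] := lx; have [r [ur fr] ter] := sup_adherent e0 supS.
have rt : r <= t by apply: ub_le_sup => //; exists v.
rewrite -(fe r)// lt_neqAle rt andbT; apply: contraTneq ft => <-.
by rewrite -leqNgt.
Qed.

Lemma left_lim_le (t u : R) (x : 'S_n) (k : 'I_n) : left_lim f t x -> 0 <= u -> u < t ->
  (Invj k (f u) <= Invj k x <= Invj k (f t))%N.
Proof.
move=> lx u0 ut; have [q [uq qt <-]] := left_lim_rat lx ut.
by apply/andP; split; apply: mono; lra.
Qed.

End paths.

(** A jump at some real time becomes a countable union of two-time conditions, from which
    measurability follows. *)
Lemma rat_jumpP (R : realType) (n : nat) (f : R -> 'S_n) (s s' : 'S_n) :
  cadlag f -> mono_path f -> code_step s s' ->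
  (exists t, 0 < t /\ left_lim f t s /\ f t = s') <->
  exists p q : rat, [/\ 0 <= (ratr p : R), (ratr p : R) <= ratr q, f (ratr p) = s & f (ratr q) = s'].
Proof.
move=> rc mono [j h]; split.
  move=> [t [t0 [ls fs']]].
  have [p [p0 pt fp]] := left_lim_rat ls t0.
  have [|q [tq _ fq]] := @right_rat _ _ _ rc t (t + 1) (ltW t0); first by rewrite ltrDl.
  by exists p, q; rewrite fq fp; split=> //; rewrite ltW// (lt_trans pt).
move=> [p [q [p0 pq fp fq]]].
have [|t [x [pt tq lx /andP[xc ct]]]] := @Invj_crossing _ _ _ rc mono j (Invj j s) _ _ p0 pq.
  by rewrite fp fq h eqxx addn1 ltnSn leqnn.
have t0 := le_lt_trans p0 pt.
(* At the crossing time of coordinate [j], monotonicity squeezes the codes of [x] and [f t] between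
   those of [s] and [s']. *)
have sq k : [/\ (Invj k s <= Invj k x)%N, (Invj k x <= Invj k (f t))%N &
    (Invj k (f t) <= Invj k s + (k == j))%N].
  rewrite -h -fq -fp; have /andP[-> ->] := left_lim_le mono k lx p0 pt.
  by split=> //; apply: mono => //; exact: ltW.
have xs : x = s.
  apply: Invj_inj => k; have [] := sq k; have [->|_] := eqVneq k j; last by lia.
  by lia.
exists t; rewrite -{1}xs; split=> //; split=> //; apply: Invj_inj => k; rewrite h.
by have [] := sq k; have [->|_] := eqVneq k j; lia.
Qed.

(** * Measures of finite and countable unions *)

Section measure_facts.
Context (d : measure_display) (T : measurableType d) (R : realType).
Variable P : probability T R.

Lemma measurable_fin_fiber (I : finType) (X : T -> I) (D : pred I) :
  (forall i, measurable [set w | X w = i]) -> measurable [set w | D (X w)].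
Proof.
move=> mX; rewrite (_ : [set w | _] = \bigcup_(i in [set` D]) [set w | X w = i]).
  by apply: fin_bigcup_measurable => //; exact: finite_finset.
by apply/seteqP; split=> w /=; [exists (X w)|case=> i /= ? ->].
Qed.

Lemma measure_fin_fiber (I : finType) (X : T -> I) (D : pred I) :
  (forall i, measurable [set w | X w = i]) ->
  P [set w | D (X w)] = (\sum_(i | D i) P [set w | X w = i])%E.
Proof.
move=> mX; pose r := [seq i <- index_enum I | D i]; rewrite -big_filter -/r.
have -> : [set w | D (X w)] = [set w | X w \in r].
  by apply: eq_set => w; rewrite mem_filter mem_index_enum andbT.
have : uniq r by rewrite filter_uniq// index_enum_uniq.
elim: r => [_|i r IH /= /andP[ir ur]].
  by rewrite big_nil (_ : [set w | _] = set0) ?measure0//; apply/seteqP; split.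
rewrite big_cons -IH// -measureU//; last 2 first.
- exact: (@measurable_fin_fiber I X (fun i => i \in r)).
- by apply/seteqP; split=> // w /= [-> ir']; rewrite ir' in ir.
congr (P _); apply/seteqP; split=> w /=; rewrite inE.
  by case/orP => [/eqP|]; [left|right].
by case=> [->|->]; rewrite ?eqxx ?orbT.
Qed.

Lemma measure_bigcup0 (I : countType) (F : I -> set T) :
  (forall i, measurable (F i)) -> (forall i, P (F i) = 0%E) -> P (\bigcup_i F i) = 0%E.
Proof.
move=> mF F0; apply/negligibleP; first exact: countable_bigcupT_measurable.
(* Re-indexing by [nat]: numbers that code no index contribute the empty set. *)
rewrite (_ : \bigcup_i F i =
  \bigcup_k (if unpickle k is Some i then F i else set0)); last first.
  apply/seteqP; split=> w [].
    by move=> i _ Fi; exists (pickle i) => //; rewrite pickleK.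
  by move=> k _; case: unpickle => // i Fi; exists i.
apply: negligible_bigcup => k; case: unpickle => [i|]; last exact: negligible_set0.
by apply/negligibleP; [exact: mF|exact: F0].
Qed.

End measure_facts.

(** * Jumps of a smooth Mallows process *)

Section mallows.
Context (d : measure_display) (T : measurableType d) (R : realType).
Variables (P : probability T R) (n : nat) (M : R -> T -> 'S_n).
Hypothesis sm : smooth P M.

Let mM t s : 0 <= t -> measurable [set w | M t w = s].
Proof. by case: sm => -[[h _ _] _] _; exact: h. Qed.

Let rc w : cadlag (fun t => M t w).
Proof. by case: sm => -[[]]. Qed.

Let mono w : mono_path (fun t => M t w).
Proof. by case: sm => -[_ h] _ j t t'; exact: h. Qed.

Let law t s : 0 <= t -> P [set w | M t w = s] = (mallows_pi t s)%:E.
Proof. by case: sm => -[[_ _]] + _ _; exact. Qed.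

Lemma jump_event_code_step (w : T) (s s' : 'S_n) : s != s' -> jump_event M s s' w ->
  code_step s s'.
Proof.
move=> neq [t [t0 [ls Ms']]]; apply: code_step_le => // [k|].
  by have /andP[_] := left_lim_le (@mono w) k ls (lexx 0) t0; rewrite Ms'.
by rewrite -Ms'; apply: sm.2 ls.
Qed.

Lemma measurable_two_times (p q : R) (s s' : 'S_n) : 0 <= p -> 0 <= q ->
  measurable ([set w | M p w = s] `&` [set w | M q w = s']).
Proof. by move=> p0 q0; apply: measurableI; exact: mM. Qed.

Lemma measurable_jump_event (s s' : 'S_n) : code_step s s' -> measurable (jump_event M s s').
Proof.
move=> st.
rewrite (_ : jump_event M s s' = \bigcup_(pq : rat * rat)
    (if (0 <= (ratr pq.1 : R)) && ((ratr pq.1 : R) <= ratr pq.2)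
     then [set w | M (ratr pq.1) w = s] `&` [set w | M (ratr pq.2) w = s'] else set0)).
  apply: countable_bigcupT_measurable => [|[p q]/=]; first exact: countableP.
  by case: ifP => // /andP[p0 pq]; apply: measurable_two_times => //; exact: le_trans pq.
apply/seteqP; split=> w.
  move=> /(rat_jumpP (@rc w) (@mono w) st)[p [q [p0 pq Mp Mq]]].
  by exists (p, q) => //=; rewrite p0 pq.
move=> [[p q] _] /=; case: ifP => // /andP[p0 pq] [Mp Mq].
by apply/(rat_jumpP (@rc w) (@mono w) st); exists p, q.
Qed.

Lemma jump_event_gt0 (p q : rat) (s s' : 'S_n) : code_step s s' ->
  0 <= (ratr p : R) -> (ratr p : R) <= ratr q ->
  (0 < P ([set w | M (ratr p) w = s] `&` [set w | M (ratr q) w = s']))%E ->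
  (0 < P (jump_event M s s'))%E.
Proof.
move=> st p0 pq /lt_le_trans; apply; apply: le_measure; rewrite ?inE.
- by apply: measurable_two_times => //; exact: le_trans pq.
- exact: measurable_jump_event.
- by move=> w [Mp Mq]; apply/(rat_jumpP (@rc w) (@mono w) st); exists p, q.
Qed.

Lemma trans_edge_hcube (s s' : 'S_n) : trans_edge P M s s' -> hcube_edge s s'.
Proof.
have key x y : x != y -> (0 < P (jump_event M x y))%E -> hcube_edge x y.
  move=> xy; have [[w Jw] _|] := pselect (exists w, jump_event M x y w).
    exact: code_step_edge (jump_event_code_step xy Jw).
  move=> noJ; rewrite (_ : jump_event M x y = set0) ?measure0 ?ltxx//.
  by apply/seteqP; split=> // w Jw; apply: noJ; exists w.
move=> [neq [|]]; first exact: key.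
by rewrite eq_sym in neq => /(key _ _ neq)/hcube_edge_sym.
Qed.

Lemma mallows_pi_gt0 (t : R) (s : 'S_n) : 0 < t -> 0 < mallows_pi t s.
Proof.
move=> t0; rewrite divr_gt0 ?exprn_gt0// prodr_gt0// => k _.
by rewrite big_ord_recl ltr_pwDl// sumr_ge0// => l _; rewrite exprn_ge0// ltW.
Qed.

(** Only terms with exponent zero survive, since [0 ^+ 0 = 1]; in particular each factor of the
    denominator is 1. *)
Lemma mallows_pi0 (s : 'S_n) : mallows_pi (0 : R) s = (Defs.Inv s == 0%N)%:R.
Proof.
rewrite /mallows_pi expr0n big1 ?divr1// => k _.
by rewrite big_ord_recl big1 ?addr0// => l _; rewrite expr0n.
Qed.

Lemma adjacent_edge (tau : 'S_n) : adjacent_transposition tau ->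
  generator (trans_edge P M) tau.
Proof.
move=> [i [j [ji ->]]]; exists 1%g, (tperm i j); split; last first.
  by apply/composeE; rewrite mulg1.
have Inv1 : Defs.Inv (1%g : 'S_n) = 0%N.
  rewrite Inv_sum big1// => k _; rewrite InvjE; apply: eq_card0 => l.
  by rewrite !inE !perm1; lia.
have st : code_step 1%g (tperm i j).
  exists j => k; rewrite -[tperm i j]mulg1; apply: Invj_swap; rewrite ?perm1 ?ji//.
  (* The values [i] and [j = i + 1] of the identity are consecutive. *)
  move=> l lj li; rewrite !perm1; apply/idP/idP; last by lia.
  by move=> il; move: lj; rewrite ltnS leqNgt il.
split; [exact: code_step_neq|left]; apply: (@jump_event_gt0 0 1) => //.
- by rewrite raddf0.
- by rewrite raddf0 rmorph1.
rewrite raddf0 rmorph1 setIC.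
(* Since [M 0 = 1] almost surely, intersecting with that event keeps the probability. *)
have <- : P [set w | M 1 w = tperm i j] =
    P ([set w | M 1 w = tperm i j] `&` [set w | M 0 w = 1%g]).
  have := probability_setC P (mM 1%g (lexx 0)).
  rewrite law// mallows_pi0 Inv1 eqxx subee// => N0.
  rewrite -[X in P X = _]setIT -(setUv [set w | M 0 w = 1%g]) setIUr measureU0//.
  - exact: measurable_two_times.
  - by apply: measurableI; [exact: mM|apply: measurableC; exact: mM].
  - apply: subset_measure0 N0 => //.
    + by apply: measurableI; [exact: mM|apply: measurableC; exact: mM].
    + by apply: measurableC; exact: mM.
by rewrite law// lte_fin mallows_pi_gt0.
Qed.

(** * Tail probabilities of one coordinate *)

(** An explicit rational function of [t] stands in for the probability in [tailE], so that
    continuity in [t] can be read off. *)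
Definition tail (k : 'I_n) (m : nat) (t : R) : R :=
  \sum_(s : 'S_n | (m <= Invj k s)%N) mallows_pi t s.

Lemma measurable_Invj (D : nat -> bool) (k : 'I_n) (t : R) : 0 <= t ->
  measurable [set w | D (Invj k (M t w))].
Proof.
move=> t0; apply: (@measurable_fin_fiber _ _ _ (M t) (fun s => D (Invj k s))) => s.
exact: mM.
Qed.

Lemma tailE (k : 'I_n) (m : nat) (t : R) : 0 <= t ->
  P [set w | (m <= Invj k (M t w))%N] = (tail k m t)%:E.
Proof.
move=> t0; rewrite (@measure_fin_fiber _ _ _ P _ (M t) (fun s => (m <= Invj k s)%N)).
  by rewrite -sumEFin; apply: eq_bigr => s _; exact: law.
by move=> s; exact: mM.
Qed.

(** The process itself is a monotone coupling of the laws: the tail events at [t] and [t'] are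
    nested. *)
Lemma tail_mono (k : 'I_n) (m : nat) (t t' : R) : 0 <= t -> t <= t' ->
  tail k m t <= tail k m t'.
Proof.
move=> t0 tt'; have t'0 := le_trans t0 tt'; rewrite -lee_fin -!tailE//.
apply: le_measure; rewrite ?inE.
- exact: (measurable_Invj (fun x => (m <= x)%N)).
- exact: (measurable_Invj (fun x => (m <= x)%N)).
- by move=> w /= /leq_trans; apply; exact: mono.
Qed.

(** A quotient of polynomials whose denominator is positive for [t >= 0], each factor having
    constant term 1. *)
Lemma tail_cvg (k : 'I_n) (m : nat) (t : R) : 0 <= t -> tail k m u @[u --> t] --> tail k m t.
Proof.
move=> t0.
pose A : {poly R} := \sum_(s : 'S_n | (m <= Invj k s)%N) 'X^(Defs.Inv s).
pose Z : {poly R} := \prod_(i < n) \sum_(l < i.+1) 'X^l.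
have tailAZ u : tail k m u = A.[u] / Z.[u].
  rewrite /tail -mulr_suml horner_sum; congr (_ / _).
    by apply: eq_bigr => s _; rewrite hornerXn.
  rewrite horner_prod; apply: eq_bigr => i _; rewrite horner_sum.
  by apply: eq_bigr => l _; rewrite hornerXn.
have Z0 : Z.[t] != 0.
  rewrite gt_eqF// horner_prod prodr_gt0// => i _.
  rewrite horner_sum big_ord_recl hornerXn ltr_pwDl// sumr_ge0// => l _.
  by rewrite hornerXn exprn_ge0.
rewrite (_ : tail k m = fun u => A.[u] / Z.[u]); last exact/funext.
by apply: cvgM; [|apply: cvgV => //]; exact: continuous_horner.
Qed.

(** The state [s] has positive weight and counts only in the larger tail. *)
Lemma tail_gt (k : 'I_n) (s : 'S_n) (t : R) : 0 < t ->
  tail k (Invj k s).+1 t < tail k (Invj k s) t.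
Proof.
move=> t0; rewrite /tail [X in _ < X](bigID (fun s0 => (Invj k s < Invj k s0)%N))/=.
rewrite [X in _ < X + _](eq_bigl (fun s0 => (Invj k s < Invj k s0)%N)); last first.
  by move=> s0 /=; apply/andb_idl => /ltnW.
rewrite ltrDl (bigD1 s) ?ltnn ?leqnn//= ltr_pwDl ?mallows_pi_gt0//.
by apply: sumr_ge0 => s0 _; rewrite ltW// mallows_pi_gt0.
Qed.

(** The point [a] is the last time at which [F] is at most half of [F 1]; monotonicity bounds such
    times by 1, and beyond [a] the level is exceeded. *)
Lemma tail_increase_point (j : 'I_n) (s : 'S_n) (c : nat) : (c < Invj j s)%N ->
  exists2 a : R, 0 < a & forall b, a < b -> tail j c.+1 a < tail j c.+1 b.
Proof.
move=> cs; set F := tail j c.+1.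
have F0 : F 0 = 0.
  apply: big1 => s0 cs0; rewrite mallows_pi0 Inv_sum (bigD1 j)//=.
  by rewrite addn_eq0; move: cs0; case: Invj.
have F1 : 0 < F 1.
  rewrite /F /tail (bigD1 s)//= ltr_pwDl ?mallows_pi_gt0//.
  by apply: sumr_ge0 => s0 _; rewrite ltW// mallows_pi_gt0.
pose S := [set t | 0 <= t /\ F t <= F 1 / 2].
have S1 : ubound S 1.
  move=> t [t0 Ft]; rewrite leNgt; apply/negP => /ltW t1.
  by have := tail_mono j c.+1 ler01 t1; rewrite -/F; lra.
have nS t : S t -> t <= sup S by apply: ub_le_sup; exists 1.
have S0 : S 0 by split=> //; rewrite F0 divr_ge0// ltW.
have supS : has_sup S by split; [exists 0|exists 1].
have a0 : 0 < sup S.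
  (* [F] vanishes at 0 and is continuous there, so it stays below the level for a while and the
     supremum is positive. *)
  have /cvgr_lt/(_ (F 1 / 2)) := @tail_cvg j c.+1 _ (lexx 0).
  rewrite -/F F0 => /(_ (divr_gt0 F1 (ltr0Sn _ _)))[e /= e0 Fe].
  apply: (@lt_le_trans _ _ (e / 2)); first by rewrite divr_gt0.
  apply: nS; split; first by rewrite divr_ge0// ltW.
  by apply/ltW/Fe => /=; rewrite sub0r normrN gtr0_norm ?divr_gt0//; lra.
have Fa : F (sup S) <= F 1 / 2.
  rewrite leNgt; apply/negP => Fa.
  (* If [F] exceeded the level at the supremum, it would do so nearby, where [S] has points. *)
  have /cvgr_gt/(_ _ Fa)[e /= e0 Fe] := @tail_cvg j c.+1 _ (ltW a0).
  have [r Sr er] := sup_adherent e0 supS.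
  have := Fe r; rewrite -/F /= ltr_distl.
  have := nS _ Sr; case: Sr => _; lra.
exists (sup S) => // b ab; apply: le_lt_trans Fa _; rewrite ltNge; apply/negP => Fb.
have := nS b; rewrite /S/= Fb (ltW (lt_trans a0 ab)) => /(_ (conj isT isT)).
by rewrite leNgt ab.
Qed.

(** If all these two-time events were null, so would be their countable union [C]. But every path
    that rises above [c] between [a] and [b] lies in [C], so the tail could not grow. The slack up
    to [b'] leaves room for a rational time after a crossing at [b]. *)
Lemma crossing_prob_gt0 (j : 'I_n) (c : nat) (a b b' : R) : 0 <= a -> a < b -> b < b' ->
  tail j c.+1 a < tail j c.+1 b ->
  exists p q : rat, [/\ a <= ratr p, (ratr p : R) <= ratr q, ratr q <= b' &
   (0 < P ([set w | Invj j (M (ratr p) w) = c] `&` [set w | Invj j (M (ratr q) w) = c.+1]))%E].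
Proof.
move=> a0 ab bb' lt_tail.
pose ok (pq : rat * rat) := [&& a <= ratr pq.1, (ratr pq.1 : R) <= ratr pq.2 & ratr pq.2 <= b'].
pose E (p q : rat) := [set w | Invj j (M (ratr p) w) = c] `&` [set w | Invj j (M (ratr q) w) = c.+1].
have mE p q : ok (p, q) -> measurable (E p q).
  move=> /and3P[/= ap pq _]; have p0 := le_trans a0 ap; have q0 := le_trans p0 pq.
  rewrite /E (_ : [set w | _ = c] = [set w | Invj j (M (ratr p) w) == c]).
    rewrite (_ : [set w | _ = c.+1] = [set w | Invj j (M (ratr q) w) == c.+1]).
      by apply: measurableI; exact: (measurable_Invj (eq_op^~ _)).
    by apply/seteqP; split=> w /= /eqP.
  by apply/seteqP; split=> w /= /eqP.
have [[p [q [/and3P[ap pq qb] Epq]]]|none] :=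
    pselect (exists p q, ok (p, q) /\ (0 < P (E p q))%E).
  by exists p, q.
exfalso.
pose C := \bigcup_(pq : rat * rat) (if ok pq then E pq.1 pq.2 else set0).
have mC : measurable C.
  apply: countable_bigcupT_measurable => [|[p q]]; first exact: countableP.
  by case: ifP => // /mE.
have C0 : P C = 0%E.
  apply: measure_bigcup0 => [[p q]|[p q]]; case: ifP => //.
    by move=> /mE.
  move=> okpq; apply/eqP; rewrite eq_le measure_ge0 andbT leNgt.
  by apply/negP => Epq; apply: none; exists p, q.
have mU t : 0 <= t -> measurable [set w | (c < Invj j (M t w))%N].
  by move=> t0; exact: (measurable_Invj (fun x => (c < x)%N)).
suff : (P [set w | (c < Invj j (M b w))%N] <= P [set w | (c < Invj j (M a w))%N])%E.
  by rewrite !tailE ?(ltW (le_lt_trans a0 ab))// lee_fin leNgt lt_tail.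
rewrite -[leRHS](measureU0 (mU a a0) mC C0); apply: le_measure; rewrite ?inE.
- by apply: mU; rewrite (ltW (le_lt_trans a0 ab)).
- by apply: measurableU => //; exact: mU.
move=> w /= cb; have [ca|ca] := ltnP c (Invj j (M a w)); [by left|right].
have [|t [x [at_ tb lx /andP[xc ct]]]] :=
    @Invj_crossing _ _ _ (@rc w) (@mono w) j c _ _ a0 (ltW ab); first by rewrite ca.
have t0 := le_lt_trans a0 at_.
have [p [ap pt Mp]] := left_lim_rat lx at_.
have [q [tq qb Mq]] := right_rat (@rc w) (ltW t0) (le_lt_trans tb bb').
have st : code_step x (M t w).
  apply: (jump_event_code_step (w := w)); last by exists t.
  by apply: contraTneq xc => ->; rewrite -ltnNge.
(* Jumps are by one unit, so crossing level [c] means going exactly from [c] to [c.+1]. *)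
have step1 : (Invj j (M t w) <= (Invj j x).+1)%N.
  by case: st => i ->; rewrite -addn1 leq_add2l leq_b1.
exists (p, q) => //=.
rewrite /ok/= (ltW ap) (ltW qb) (ltW (lt_trans pt tq)) /E /= Mp Mq.
by move: (Invj j x) (Invj j (M t w)) xc ct step1; clear => m m' *; split; lia.
Qed.

(** * Realizing every hypercube edge under independence *)

Lemma hcube_edge_trans (s s' : 'S_n) : inv_processes_independent P M ->
  code_step s s' -> (0 < P (jump_event M s s'))%E.
Proof.
move=> indep st; have [j h] := st; set c := Invj j s.
have [a a0 ainc] : exists2 a : R, 0 < a & forall b, a < b -> tail j c.+1 a < tail j c.+1 b.
  by apply: (@tail_increase_point _ s'); rewrite h eqxx addn1.
(* At [a] the strict inequality is [tail_gt]; by right-continuity it survives at some [b' > a], for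
   all of the finitely many [k] at once. *)
have [b' ab' stay] : exists2 b', a < b' &
    forall k, tail k (Invj k s).+1 b' < tail k (Invj k s) a.
  have : \forall b \near a^'+, a < b /\ forall k, tail k (Invj k s).+1 b < tail k (Invj k s) a.
    apply: filterI (nbhs_right_gt a) _.
    refine (@filter_forall _ 'I_n
      (fun k b => tail k (Invj k s).+1 b < tail k (Invj k s) a) a^'+ _ _) => k.
    by apply: (cvgr_lt _ (cvg_at_right_filter (@tail_cvg k _ _ (ltW a0)))); exact: tail_gt.
  by move=> /filter_ex[b [? ?]]; exists b.
(* The midpoint of [a] and [b'] serves as [b], so both rational times lie in [[a, b']]. *)
have [p [q [ap pq qb jp]]] := crossing_prob_gt0 (ltW a0) (midf_lt ab').1 (midf_lt ab').2
  (ainc _ (midf_lt ab').1).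
have p0 := le_trans (ltW a0) ap; have q0 := le_trans p0 pq.
apply: (@jump_event_gt0 p q) => //.
(* Index 0 stands for time [p] and the code of [s], index 1 for time [q] and the code of [s']. *)
pose v k i := if i == 0%N then Invj k s else Invj k s'.
pose ts : seq R := [:: ratr p; ratr q].
have cylE k : inv_cyl_event M ts v k =
    [set w | Invj k (M (ratr p) w) = Invj k s] `&` [set w | Invj k (M (ratr q) w) = Invj k s'].
  apply/seteqP; split=> w /=; first by move=> H; split; [exact: (H 0%N)|exact: (H 1%N)].
  by move=> [H0 H1] [|[|//]].
have -> : [set w | M (ratr p) w = s] `&` [set w | M (ratr q) w = s'] =
    [set w | forall k, k \in [set: 'I_n]%SET -> inv_cyl_event M ts v k w].
  apply/seteqP; split=> w /=; first by move=> [Mp Mq] k _; rewrite cylE/= Mp Mq.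
  by move=> H; split; apply: Invj_inj => k; have := H k; rewrite inE cylE => /(_ isT)[].
(* Independence over all coordinates gives a product; the factor at [j] is positive by [jp], and the
   others are treated below. *)
rewrite indep; last by move=> [|[|//]].
apply: (big_ind (fun x => 0 < x)%E) => [|x y|k _]; [exact: lte01|exact: mule_gt0|].
rewrite cylE h; have [->|kj] := eqVneq k j; first by rewrite addn1.
rewrite addn0.
have meq t : 0 <= t -> measurable [set w | Invj k (M t w) = Invj k s].
  move=> t0; rewrite (_ : [set w | _] = [set w | Invj k (M t w) == Invj k s]).
    exact: (measurable_Invj (eq_op^~ _)).
  by apply/seteqP; split=> w /= /eqP.
set E := _ `&` _; have mE : measurable E by apply: measurableI; exact: meq.
have b'0 : 0 <= b' := ltW (lt_trans a0 ab').
have mU m t : 0 <= t -> measurable [set w | (m <= Invj k (M t w))%N].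
  by move=> t0; exact: (measurable_Invj (fun x => (m <= x)%N)).
(* A coordinate at least [Invj k s] at [a] and at most that at [b'] equals it at [p] and [q] too. If
   [E] were null, this bound would contradict [stay]. *)
have : (P [set w | (Invj k s <= Invj k (M a w))%N] <=
    P E + P [set w | (Invj k s < Invj k (M b' w))%N])%E.
  apply: le_trans (measureU2 P mE (mU _ _ b'0)).
  apply: le_measure; rewrite ?inE.
  - exact/mU/ltW.
  - by apply: measurableU => //; exact: mU.
  move=> w /= sa; have [|bs] := ltnP (Invj k s) (Invj k (M b' w)); [by right|left].
  have Hap := mono w k (ltW a0) ap; have Hpq := mono w k p0 pq.
  have Hqb := mono w k q0 qb.
  by split; apply/eqP; rewrite eqn_leq; apply/andP; split;
    [exact: leq_trans Hpq (leq_trans Hqb bs)|exact: leq_trans sa Hap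
    |exact: leq_trans Hqb bs|exact: leq_trans sa (leq_trans Hap Hpq)].
rewrite !tailE ?(ltW a0)// => le_tail; rewrite lt_neqAle measure_ge0 andbT eq_sym.
apply: contraTneq le_tail => ->; rewrite add0e lee_fin -ltNge; exact: stay.
Qed.

End mallows.

Theorem theorem2 (d : measure_display) (T : measurableType d) (R : realType)
    (P : probability T R) (n : nat) (M : R -> T -> 'S_n) :
  smooth P M ->
  (forall s s', trans_edge P M s s' -> hcube_edge s s') /\
  (forall tau, adjacent_transposition tau -> generator (trans_edge P M) tau) /\
  (forall tau, generator (trans_edge P M) tau -> transposition tau) /\
  (regular P M ->
     (forall s s', trans_edge P M s s' <-> hcube_edge s s') /\
     (forall tau, generator (trans_edge P M) tau <-> generator (@hcube_edge n) tau) /\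
     (forall tau, generator (@hcube_edge n) tau <-> transposition tau)).
Proof.
move=> sm.
have sub s s' : trans_edge P M s s' -> hcube_edge s s' := @trans_edge_hcube _ _ _ _ _ _ sm s s'.
split=> //; split; first by move=> tau; exact: adjacent_edge.
split=> [tau [s [s' [/sub e tauE]]]|[_ indep]].
  by apply/generator_hcube; exists s, s'.
have edge s s' : trans_edge P M s s' <-> hcube_edge s s'.
  split; first exact: sub.
  (* Jumps go upwards, so the orientation of the edge decides which jump event is shown to have
     positive probability. *)
  move=> /edge_code_step[] st; split.
  - exact: code_step_neq.
  - by left; exact: hcube_edge_trans.
  - by rewrite eq_sym; exact: code_step_neq.
  - by right; exact: hcube_edge_trans.
split=> //; split; last exact: generator_hcube.
by move=> tau; split=> -[s [s' [/edge e tauE]]]; exists s, s'.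
Qed.
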